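(* Let $p\in[1,\log m]$, $\mu\le m$ and $\tilde D\le m^m$. Then every deterministic online algorithm for load balancing of temporary tasks with predicted durations has competitive ratio at least $$\Omega\left(\mu^{\frac{p}{2p-1}-\frac1p}+p+\left(\frac{\log\tilde D}{\log\log\tilde D}\right)^{\frac{p}{2p-1}-\frac1p}\right)$$ for the $\ell_p$-norm objective. In particular, for the $\ell_\infty$-norm objective the competitive ratio is at least $\Omega\left(\sqrt{\mu}+\log m+\sqrt{\frac{\log\tilde D}{\log\log\tilde D}}\right)$. These lower bounds hold even in the restricted assignment model.
   Context: Load balancing of temporary tasks with predictions: there are $m$ machines. Jobs arrive online at integer time steps. Job $j$ has an arrival time $t_j$, an actual integer duration $d_j\ge 1$, and a load $p_{ij}\in\mathbb{R}_+\cup\{\infty\}$ if assigned to machine $i$; it is alive during time slots $t_j+1,\dots,t_j+d_j$. Upon arrival of job $j$ the algorithm learns $t_j$, the loads $p_{ij}$ and a real estimate $\tilde d_j\ge1$ of its duration, but not $d_j$, and must irrevocably assign $j$ to a machine. $\tilde D=\max_j\tilde d_j$. With $\mu_1,\mu_2\ge1$ such that $d_j\in[\lceil\tilde d_j/\mu_2\rceil,\lfloor\mu_1\tilde d_j\rfloor]$ for all $j$, the distortion is $\mu=\mu_1\mu_2$. The load of machine $i$ at time slot $t$ is $\ell_i(t)=\sum p_{ij}$ over jobs assigned to $i$ alive at $t$, and the objective is $\max_t\|\ell(t)\|_p$ ($\|\cdot\|_\infty$ is the maximum coordinate). The competitive ratio of an online algorithm is the supremum, over inputs with the given parameters (distortion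 $\mu$, maximum estimate $\tilde D$, $m$ machines), of the ratio between its objective value and that of an optimal offline assignment. In the restricted assignment model, each job $j$ has a single load $p_j$ and $p_{ij}\in\{p_j,\infty\}$ for every machine $i$.
   Formalization: Logs are base 2 and log log D̃ is replaced by max(1, log log D̃), since the quotient is undefined or unbounded for D̃ < 4; parameters μ, D̃ for which no input exists (e.g. μ = 1, D̃ = 1.5) are excluded. *)

(* Defs.v *)
From HB Require Import structures.
From mathcomp Require Import all_boot all_order all_algebra.
From mathcomp Require Import all_classical all_reals all_analysis.

Set Implicit Arguments.
Unset Strict Implicit.
Unset Printing Implicit Defensive.

Import Order.TTheory GRing.Theory Num.Theory.
Local Open Scope classical_set_scope.
Local Open Scope ring_scope.

(* Time is discrete: slot t is the interval between time steps t - 1 and t,    *)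
(* so a job arriving at step t_j is first alive in slot t_j + 1.               *)
Record job (R : realType) (m : nat) := Job {
  arrival : nat;
  load : 'I_m -> \bar R;
  estimate : R;
  duration : nat
}.

Definition valid_job (R : realType) (m : nat) (j : job R m) : Prop :=
  [/\ (1 <= duration j)%N, 1 <= estimate j & forall i, (0 <= load j i)%E].

Definition restricted_job (R : realType) (m : nat) (j : job R m) : Prop :=
  exists q : R, forall i, load j i = q%:E \/ load j i = +oo%E.

Definition job_distortion (R : realType) (m : nat) (mu1 mu2 : R) (j : job R m)
    : Prop :=
  Num.ceil (estimate j / mu2) <= (duration j)%:Z <= Num.floor (mu1 * estimate j).

Definition alive (R : realType) (m : nat) (j : job R m) (t : nat) : bool :=
  (arrival j < t <= arrival j + duration j)%N.

(* An instance lists the jobs in order of presentation; jobs with the same     *)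
(* arrival time are presented one after the other.                             *)
Notation instance R m := (seq (job R m)).

Definition job_at (R : realType) (m : nat) (s : instance R m)
  (k : 'I_(size s)) : job R m := tnth (in_tuple s) k.
Arguments job_at {R m} s k.

Inductive model := GeneralLoads | RestrictedAssignment.

Definition in_model (R : realType) (m : nat) (M : model) (s : instance R m)
    : Prop :=
  match M with
  | GeneralLoads => True
  | RestrictedAssignment => forall k, restricted_job (job_at s k)
  end.

Definition has_distortion (R : realType) (m : nat) (mu : R) (s : instance R m)
    : Prop :=
  exists mu1 mu2 : R, [/\ 1 <= mu1, 1 <= mu2, mu1 * mu2 = mu &
    forall k, job_distortion mu1 mu2 (job_at s k)].

Definition max_estimate (R : realType) (m : nat) (s : instance R m) : R :=
  \big[Num.max/0]_(j <- s) estimate j.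

(* The inputs of the model M with m machines, distortion mu and maximum        *)
(* estimate D.                                                                 *)
Definition inputs (R : realType) (m : nat) (M : model) (mu D : R)
    : set (instance R m) :=
  [set s | [/\ sorted (fun j k : job R m => (arrival j <= arrival k)%N) s,
               forall k, valid_job (job_at s k),
               in_model M s, has_distortion mu s & max_estimate s = D]].
Arguments inputs {R} m M mu D.

Definition assignment (R : realType) (m : nat) (s : instance R m) : Type :=
  {ffun 'I_(size s) -> 'I_m}.

Definition machine_load (R : realType) (m : nat) (s : instance R m)
    (a : assignment s) (t : nat) (i : 'I_m) : \bar R :=
  (\sum_(k < size s | (a k == i) && alive (job_at s k) t)
     load (job_at s k) i)%E.

Definition lpnorm (R : realType) (m : nat) (p : R) (v : 'I_m -> \bar R)
    : \bar R :=
  ((\sum_(i < m) `|v i| `^ p) `^ p^-1)%E.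

Definition maxnorm (R : realType) (m : nat) (v : 'I_m -> \bar R) : \bar R :=
  (\big[maxe/0]_(i < m) `|v i|)%E.

(* Only finitely many slots have an alive job, so the supremum is a maximum.   *)
Definition objective (R : realType) (m : nat)
    (N : ('I_m -> \bar R) -> \bar R) (s : instance R m) (a : assignment s)
    : \bar R :=
  ereal_sup (range (fun t : nat => N (machine_load a t))).

Definition opt (R : realType) (m : nat) (N : ('I_m -> \bar R) -> \bar R)
    (s : instance R m) : \bar R :=
  ereal_inf (range (@objective R m N s)).

(* What is known about a job at its arrival.                                   *)
Record announced (R : realType) (m : nat) := Announced {
  ann_arrival : nat;
  ann_load : 'I_m -> \bar R;
  ann_estimate : R
}.

Definition announce (R : realType) (m : nat) (j : job R m) : announced R m :=
  Announced (arrival j) (load j) (estimate j).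

(* At time step t the duration of an earlier job is known exactly when the job *)
(* has already left, i.e. it is alive in no slot after t.                      *)
Definition observe (R : realType) (m : nat) (t : nat) (j : job R m)
    : announced R m * option nat :=
  (announce j,
   if (arrival j + duration j <= t)%N then Some (duration j) else None).

(* A deterministic algorithm for m machines maps the earlier jobs, as observed *)
(* at the current time, and the announcement of the current job to a machine;  *)
(* its own earlier decisions are determined by this information.               *)
Definition online_algorithm (R : realType) (m : nat) : Type :=
  seq (announced R m * option nat) -> announced R m -> 'I_m.

Definition run (R : realType) (m : nat) (A : online_algorithm R m)
    (s : instance R m) : assignment s :=
  [ffun k : 'I_(size s) =>
     A [seq observe (arrival (job_at s k)) j | j <- take k s]
       (announce (job_at s k))].

(* Division on \bar R satisfies x / 0 = +oo for x > 0, and 0 / 0 = +oo / +oo   *)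
(* = 0, so the inputs whose ratio is undefined do not contribute.              *)
Definition competitive_ratio (R : realType) (m : nat)
    (N : ('I_m -> \bar R) -> \bar R) (A : online_algorithm R m)
    (I : set (instance R m)) : \bar R :=
  ereal_sup [set (objective N (run A s) / opt N s)%E | s in I].

Definition log2 (R : realType) (x : R) : R := ln x / ln 2.

(* log x / log log x; the maximum with 1 only matters for x < 4, where         *)
(* log log x is undefined, negative or close to 0.                             *)
Definition log_over_loglog (R : realType) (x : R) : R :=
  log2 x / Num.max 1 (log2 (log2 x)).

(* Main.v *)
Require Import Defs.
From HB Require Import structures.
From mathcomp Require Import all_boot all_order all_algebra.
From mathcomp Require Import all_classical all_reals all_analysis.
From mathcomp Require Import zify ring lra.
Import Order.TTheory GRing.Theory Num.Theory.
Local Open Scope classical_set_scope.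
Local Open Scope ring_scope.

Set Implicit Arguments.
Unset Strict Implicit.
Unset Printing Implicit Defensive.

(* An adversary plays unit jobs against the algorithm and keeps an offline     *)
(* assignment that puts at most one alive job on each of N machines, so that   *)
(* the optimum is at most N^(1/p).                                             *)
(*                                                                             *)
(* For the term p, play a knock-out tournament on 2^k machines, k = floor p:   *)
(* each job is allowed on the winners w1, w2 of two halves, the machine chosen *)
(* online advances and the offline assignment uses the other one. The final    *)
(* winner carries k jobs online and none offline, so it can take one more.     *)
(*                                                                             *)
(* For the other two terms there are [a] common machines and [n] steps, each   *)
(* with a private machine. A step offers up to [a] jobs, allowed on the common *)
(* machines and on its private machine, until one is placed on a common        *)
(* machine. That job is long: it survives the remaining steps, and offline it  *)
(* uses the private machine. The earlier jobs of the step are over before the  *)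
(* next step, so offline they share the common machines with those of all      *)
(* other steps. Online, either a private machine carries [a] jobs at once, or  *)
(* the common machines carry [n] jobs in the end; [a] about n^(p/(2p-1))       *)
(* balances the two norms. With distortion mu, n + 1 <= mu steps are possible  *)
(* because only the actual duration tells long from short jobs. With exact     *)
(* estimates, the r-th job of a step lasts r time windows, each long enough    *)
(* for the remaining steps, so durations reach a^n <= D.                       *)
(*                                                                             *)
(* For p = log2 m the maximum norm and the p-norm differ by a factor at most 2.*)

(** The algorithm is deterministic, so a game against it is a [transcript] holding its answers next
    to an offline assignment. A forbidden choice costs infinite load, so the algorithm must obey the
    restrictions. [competitive_ratio_ge] turns a transcript of online norm at least [v], with
    offline load at most one on each of [N] machines, into the ratio [v / N^(1/p)].

    In [window_game] the online norm is at least the minimum of [a] and [n * a^(1/p - 1)], the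
    latter by the power mean inequality, while the optimum is at most [(a + n)^(1/p)]. Balancing
    ([window_parameters]) gives a ratio of order [n^(p/(2p-1) - 1/p)]; [distortion_ratio] and
    [duration_ratio] apply this with [n] of order [mu] and of order [log D / log log D]. Together
    with [tournament_ratio] this yields [lpnorm_ratio], and [maxnorm_ratio] at [p = log2 m]
    transfers it to the maximum norm. *)

Record move (R : realType) (m : nat) := Move {
  mjob : job R m;
  online : 'I_m;
  offline : 'I_m
}.

Definition unit_load (R : realType) (m : nat) (S : pred 'I_m) (i : 'I_m)
    : \bar R :=
  if S i then 1%E else +oo%E.

Definition unit_job (R : realType) (m : nat) (ok : R -> nat -> Prop)
    (j : job R m) : Prop :=
  (exists S : pred 'I_m, load j = unit_load R S) /\ ok (estimate j) (duration j).

Definition answer (R : realType) (m : nat) (A : online_algorithm R m)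
    (h : seq (move R m)) (j : job R m) : 'I_m :=
  A [seq observe (arrival j) (mjob e) | e <- h] (announce j).

(* Since [answer] does not read the duration of [j], the adversary may fix it  *)
(* after seeing the machine chosen by the algorithm.                           *)
Inductive transcript (R : realType) (m : nat) (A : online_algorithm R m)
    (ok : R -> nat -> Prop) : seq (move R m) -> Prop :=
| TranscriptNil : transcript A ok [::]
| TranscriptRcons h j y : transcript A ok h -> unit_job ok j ->
    load j y = 1%E -> all (fun e => arrival (mjob e) <= arrival j)%N h ->
    transcript A ok (rcons h (Move j (answer A h j) y)).

Definition online_count (R : realType) (m : nat) (h : seq (move R m))
    (t : nat) (i : 'I_m) : nat :=
  count (fun e => (online e == i) && alive (mjob e) t) h.

Definition offline_count (R : realType) (m : nat) (h : seq (move R m))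
    (t : nat) (i : 'I_m) : nat :=
  count (fun e => (offline e == i) && alive (mjob e) t) h.

(** A forbidden choice of the algorithm that is visible in slot [t]; it wins the game for the
    adversary at once. *)
Definition overloaded (R : realType) (m : nat) (h : seq (move R m)) (t : nat)
    : bool :=
  has (fun e => alive (mjob e) t && (load (mjob e) (online e) == +oo%E)) h.

Lemma online_count_rcons (R : realType) (m : nat) (h : seq (move R m)) e t i :
  online_count (rcons h e) t i =
  (online_count h t i + ((online e == i) && alive (mjob e) t))%N.
Proof. by rewrite /online_count -cats1 count_cat /= addn0. Qed.

Lemma offline_count_rcons (R : realType) (m : nat) (h : seq (move R m)) e t i :
  offline_count (rcons h e) t i =
  (offline_count h t i + ((offline e == i) && alive (mjob e) t))%N.
Proof. by rewrite /offline_count -cats1 count_cat /= addn0. Qed.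

Lemma sum_online_count (R : realType) (m : nat) (P : pred 'I_m)
    (h : seq (move R m)) t :
  (\sum_(i < m | P i) online_count h t i =
   count (fun e => P (online e) && alive (mjob e) t) h)%N.
Proof.
elim/last_ind: h => [|h e IH]; first by rewrite big1.
under eq_bigr do rewrite online_count_rcons.
rewrite big_split /= IH -cats1 count_cat /= addn0; congr addn.
case: (alive _ _); last by rewrite !andbF big1 // => i _; rewrite andbF.
rewrite andbT; under eq_bigr do rewrite andbT.
case: (boolP (P (online e))) => Pe; last first.
  by rewrite big1 // => i Pi; case: eqP Pe => // ->; rewrite Pi.
by rewrite (bigD1 (online e)) //= eqxx big1 // => i /andP[_]; rewrite eq_sym => /negPf ->.
Qed.

Definition unit_job_on (R : realType) (m : nat) (S : pred 'I_m) (t : nat) (e : R)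
    (d : nat) : job R m := Job t (unit_load R S) e d.

Lemma transcript_rcons (R : realType) (m : nat) (A : online_algorithm R m)
    (ok : R -> nat -> Prop) h (S : pred 'I_m) t e d y :
  transcript A ok h -> ok e d -> S y ->
  all (fun e => arrival (mjob e) <= t)%N h ->
  transcript A ok
    (rcons h (Move (unit_job_on S t e d) (answer A h (unit_job_on S t e d)) y)).
Proof.
move=> trh oked Sy arr; apply: TranscriptRcons => //.
- by split=> //; exists S.
- by rewrite /= /unit_load Sy.
Qed.

Lemma overloaded_rcons (R : realType) (m : nat) (A : online_algorithm R m) h
    (S : pred 'I_m) t e d y :
  (0 < d)%N -> ~~ S (answer A h (unit_job_on S t e d)) ->
  overloaded
    (rcons h (Move (unit_job_on S t e d) (answer A h (unit_job_on S t e d)) y))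
    t.+1.
Proof.
move=> d0 /negPf Sx; rewrite /overloaded has_rcons /= /unit_load Sx eqxx andbT.
by rewrite /alive /= ltnSn /= -addn1 leq_add2l d0.
Qed.

(** * The window game *)

Lemma offline_count_dead (R : realType) (m : nat) (h : seq (move R m)) t u i :
  all (fun e => (offline e == i) ==>
         (arrival (mjob e) + duration (mjob e) <= t))%N h ->
  (t < u)%N -> offline_count h u i = 0%N.
Proof.
move=> dead tu; elim: h dead => //= e h IH /andP[de dh].
rewrite /offline_count /= -[count _ h]/(offline_count h u i) IH // addn0.
case: eqP de => //= _ de; rewrite /alive [(u <= _)%N]leqNgt.
by rewrite (leq_ltn_trans de tu) andbF.
Qed.

(* [W k] is the length of the time window in which the last [k] steps take     *)
(* place. In the step followed by [k] others, job [r] lasts [dlong k r] if it  *)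
(* ends the step, and then the next window starts [next k r] slots later;      *)
(* otherwise it lasts [dshort k r].                                            *)
Section WindowGame.
Context (R : realType) (m : nat) (A : online_algorithm R m).
Variables (ok : R -> nat -> Prop) (a n : nat).
Variables (W : nat -> nat) (next dshort dlong : nat -> nat -> nat).
Variable (est : nat -> nat -> R).
Hypothesis machines : (a + n <= m)%N.
Hypothesis W_gt0 : forall k, (0 < W k)%N.
Hypothesis ok_short : forall k r, (k < n)%N -> (r < a)%N -> ok (est k r) (dshort k r).
Hypothesis ok_long : forall k r, (k < n)%N -> (r < a)%N -> ok (est k r) (dlong k r).
Hypothesis dshort_gt0 : forall k r, (0 < dshort k r)%N.
Hypothesis short_next :
  forall k r r', (r' < r)%N -> (r < a)%N -> (dshort k r' <= next k r)%N.
Hypothesis next_long : forall k r, (next k r + W k <= dlong k r)%N.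
Hypothesis next_window :
  forall k r, (r < a)%N -> (next k r + W k <= W k.+1)%N.

Definition window_outcome (h : seq (move R m)) : Prop :=
  [/\ transcript A ok h,
      forall t i, (offline_count h t i <= (i < a + n))%N &
      exists t, [\/ overloaded h t,
                    exists i, (a <= online_count h t i)%N |
                    (n <= \sum_(i < m | i < a) online_count h t i)%N]].

(** Invariant with [k] steps to go and a window opening at [t]: [n - k] long jobs occupy common
    machines online until the window closes, whereas offline all common machines are free again and
    only the first [n - k] private ones have been used. *)
Definition window_state (k t : nat) (h : seq (move R m)) : Prop :=
  [/\ transcript A ok h,
      all (fun e => arrival (mjob e) <= t)%N h,
      (n - k <= count (fun e => (online e < a) &&
         (t + W k <= arrival (mjob e) + duration (mjob e))) h)%N,
      all (fun e => (offline e < a) ==>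
         (arrival (mjob e) + duration (mjob e) <= t))%N h &
      forall u i, (offline_count h u i <= (i < a + (n - k)))%N].

(* During a step, whose private machine [q] has received [r] jobs.             *)
Definition step_state (k t r : nat) (q : 'I_m) (h : seq (move R m)) : Prop :=
  [/\ transcript A ok h /\ all (fun e => arrival (mjob e) <= t)%N h,
      (n - k.+1 <= count (fun e => (online e < a) &&
         (t + W k.+1 <= arrival (mjob e) + duration (mjob e))) h)%N,
      all (fun e => (offline e < a) ==>
         ((arrival (mjob e) + duration (mjob e) <= t) || ((offline e < r) &&
          (arrival (mjob e) + duration (mjob e) <= t + dshort k (offline e)))))%N h,
      forall u i, (offline_count h u i <= (i < a + (n - k.+1)))%N &
      (r <= online_count h t.+1 q)%N].

(** Induction on [a - r]: each job put on [q] brings that machine closer to [a] simultaneous jobs,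
    and any other choice ends the step or the game. *)
Lemma step_play k t r q h : (k < n)%N -> (r <= a)%N ->
  nat_of_ord q = (a + (n - k.+1))%N -> step_state k t r q h ->
  (exists t' h', window_state k t' h') \/ (exists h', window_outcome h').
Proof.
move=> kn ra qE; have [s sE] : exists s, s = (a - r)%N by exists (a - r)%N.
elim: s r ra sE h => [|s IH] r ra sE h [[trh arr] long dead off onl].
  right; exists h; split=> // [u i|].
    by apply: leq_trans (off u i) _; case: ltnP => //= ?; case: ltnP => //; lia.
  by exists t.+1; apply: Or32; exists q; apply: leq_trans onl; lia.
have {}ra : (r < a)%N by lia.
pose S : pred 'I_m := fun i => (i < a)%N || (i == q).
have rm : (r < m)%N by lia.
pose y := Ordinal rm.
set x := answer A h (unit_job_on S t (est k r) (dshort k r)).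
have offq u : offline_count h u q = 0%N.
  by apply/eqP; rewrite -leqn0; apply: leq_trans (off u q) _; rewrite qE ltnn.
have offD u i b : (offline_count h u i + ((q == i) && b) <= (i < a + (n - k)))%N.
  case: eqP => [<-|_] /=.
    rewrite offq add0n; apply: leq_trans (leq_b1 _) _.
    by rewrite lt0b qE; lia.
  by rewrite addn0; apply: leq_trans (off u i) _; case: ltnP => //= ?; case: ltnP => //; lia.
case: (boolP (x == q)) => [/eqP xq|xq].
  (* Job [r] is kept short. Offline it goes to common machine [r], where all earlier jobs are over
     by [t]. *)
  apply: (IH r.+1 ra _ (rcons h (Move (unit_job_on S t (est k r) (dshort k r)) x y)));
    first by lia.
  split.
  - split; last by rewrite all_rcons /= leqnn.
    by apply: transcript_rcons => //; [exact: ok_short|rewrite /S /= ra].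
  - by rewrite -cats1 count_cat; apply: leq_trans long (leq_addr _ _).
  - rewrite all_rcons /= ra ltnSn leqnn orbT /=.
    apply: sub_all dead => e; case: (offline e < a)%N => //= /orP[->//|/andP[er ->]].
    by rewrite ltnS (ltnW er) orbT.
  - move=> u i; rewrite offline_count_rcons /=; case: eqP => [<-|_] /=; last first.
      by rewrite addn0.
    rewrite ltn_addr //; case: (boolP (alive _ u)) => [/andP[/= tu _]|_]; last first.
      by rewrite addn0; apply: leq_trans (off u y) (leq_b1 _).
    rewrite (@offline_count_dead _ _ _ t) //.
    apply: sub_all dead => e; case: eqP => //= ->.
    by rewrite /= ra ltnn /= orbF.
  - have tlive : (t < t + dshort k r)%N by rewrite -addn1 leq_add2l dshort_gt0.
    by rewrite online_count_rcons /= xq eqxx /alive /= ltnSn tlive addn1.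
(* Otherwise the job is made long and goes offline to [q], which is empty by [offq]. The answer [x]
   is still valid, because [answer] does not see the duration. *)
pose h' d := rcons h (Move (unit_job_on S t (est k r) d) x q).
have trh' : transcript A ok (h' (dlong k r)).
  by apply: transcript_rcons => //; [exact: ok_long|rewrite /S /= eqxx orbT].
have dlong_gt0 : (0 < dlong k r)%N.
  by apply: leq_trans (next_long k r); rewrite addn_gt0 W_gt0 orbT.
case: (boolP (x < a)%N) => xa; last first.
  right; exists (h' (dlong k r)); split=> // [u i|].
    rewrite offline_count_rcons /=; apply: leq_trans (offD _ _ _) _.
    by case: ltnP => //= ?; case: ltnP => //; lia.
  exists t.+1; apply: Or31; apply: overloaded_rcons => //.
  by rewrite -/x /S negb_or xa xq.
(* The new window opens once the short jobs of this step are over, and closes before any long job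
   ends. *)
left; exists (t + next k r)%N, (h' (dlong k r)); split=> //.
- rewrite all_rcons /= leq_addr; apply: sub_all arr => e /leq_trans; apply.
  exact: leq_addr.
- rewrite /h' -cats1 count_cat /= xa -!addnA leq_add2l next_long /= addn0.
  rewrite (_ : n - k = (n - k.+1) + 1)%N; last by lia.
  rewrite leq_add2r; apply: leq_trans long _.
  apply: sub_count => e /= /andP[-> /=]; apply: leq_trans.
  by rewrite leq_add2l next_window.
- rewrite all_rcons /= qE -ltn_subRL subnn ltn0 /=.
  apply: sub_all dead => e /=; case: (offline e < a)%N => //= /orP[|/andP[er]].
    by move=> /leq_trans; apply; exact: leq_addr.
  by move=> /leq_trans; apply; rewrite leq_add2l short_next.
- by move=> u i; rewrite offline_count_rcons.
Qed.

Lemma window_game : exists h, window_outcome h.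
Proof.
have /(_ n (leqnn n)) : forall k, (k <= n)%N -> forall t h, window_state k t h ->
    exists h, window_outcome h.
  elim=> [|k IH] kn t h [trh arr long dead off]; last first.
    have qm : (a + (n - k.+1) < m)%N by lia.
    have st : step_state k t 0 (Ordinal qm) h.
      by split=> //; apply: sub_all dead => e; case: (offline e < a)%N => //= ->.
    have [[t' [h' /IH]]|//] := step_play (q := Ordinal qm) kn (leq0n a) (erefl _) st.
    by apply; apply: ltnW.
  (* No step is left: the [n] long jobs on common machines last at least until [t + W 0], so all are
     alive in slot [t + 1]. *)
  rewrite subn0 in long off; exists h; split=> //.
  exists t.+1; apply: Or33; rewrite sum_online_count.
  apply: leq_trans long _.
  elim: h arr {trh dead off} => //= e h IH /andP[ae ah].
  apply: leq_add (IH ah); case: (online e < a)%N => //=.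
  rewrite /alive ltnS ae /=; case: (leqP (t + W 0)) => //= le.
  by rewrite (leq_trans _ le) // -addn1 leq_add2l W_gt0.
apply.
apply: (_ : window_state n 0 [::]); split=> //; first exact: TranscriptNil.
by rewrite subnn.
Qed.

End WindowGame.

(** * The knock-out tournament *)

(** The recursion plays both halves of the block of [2 ^ k] machines starting at [c], then one job
    for the two winners. The last two clauses let the winner of the first half keep its counts while
    the second half is played. *)
Lemma tournament (R : realType) (m : nat) (A : online_algorithm R m)
    (ok : R -> nat -> Prop) (N k c : nat) (h : seq (move R m)) :
  ok 1 1%N -> (N <= m)%N -> (c + 2 ^ k <= N)%N -> transcript A ok h ->
  all (fun e => arrival (mjob e) <= 0)%N h ->
  (forall t (i : 'I_m), (offline_count h t i <= (i < N))%N) ->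
  (forall t (i : 'I_m), (c <= i < c + 2 ^ k)%N -> offline_count h t i = 0%N) ->
  exists h', [/\ transcript A ok h',
    all (fun e => arrival (mjob e) <= 0)%N h',
    (forall t (i : 'I_m), (offline_count h' t i <= (i < N))%N) &
    overloaded h' 1 \/
    exists w : 'I_m, [/\ (c <= w < c + 2 ^ k)%N, (k <= online_count h' 1 w)%N,
      (forall t, offline_count h' t w = 0%N),
      (forall t (i : 'I_m), ~~ (c <= i < c + 2 ^ k)%N ->
         offline_count h' t i = offline_count h t i) &
      (forall t (i : 'I_m), online_count h t i <= online_count h' t i)%N]].
Proof.
move=> ok1 Nm; elim: k c h => [|k IH] c h cN trh arr off off0.
  have cm : (c < m)%N by move: cN; rewrite expn0; lia.
  exists h; split=> //; right; exists (Ordinal cm) => /=; split=> //; first by lia.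
  by move=> t; rewrite off0 //=; lia.
rewrite expnS mul2n -addnn in cN off0 *.
have [|t i ci|h1 [tr1 arr1 off1 [ovl|[w1 [cw1 onl1 offw1 out1 mono1]]]]] :=
  IH c h _ trh arr off; [by lia|by apply: off0; lia|by exists h1; split=> //; left|].
have [|t i ci|h2 [tr2 arr2 off2 [ovl|[w2 [cw2 onl2 offw2 out2 mono2]]]]] :=
  IH (c + 2 ^ k)%N h1 _ tr1 arr1 off1;
  [by lia|by rewrite out1 ?off0 //; lia|by exists h2; split=> //; left|].
pose S : pred 'I_m := fun i => (i == w1) || (i == w2).
pose j := unit_job_on S 0 (1 : R) 1.
set x := answer A h2 j.
have w12 : w1 != w2 by apply/eqP => E; rewrite E in cw1; lia.
have off2w1 t : offline_count h2 t w1 = 0%N by rewrite out2 ?offw1 //; lia.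
have on2w1 : (k <= online_count h2 1 w1)%N := leq_trans onl1 (mono2 _ _).
(* Offline the job goes to a winner that the algorithm did not pick; that machine is empty offline
   and does not advance. *)
pose y := if x == w1 then w2 else w1.
have yw : y = w1 \/ y = w2 by rewrite /y; case: ifP; [right|left].
have off2y t : offline_count h2 t y = 0%N by case: yw => ->.
exists (rcons h2 (Move j x y)); split.
- by apply: transcript_rcons => //; rewrite /S; case: yw => ->; rewrite eqxx ?orbT.
- by rewrite all_rcons /= arr2.
- move=> t i; rewrite offline_count_rcons /=; case: eqP => [<-|_]; last by rewrite addn0.
  rewrite off2y add0n; apply: leq_trans (leq_b1 _) _; rewrite lt0b.
  by case: yw => ->; lia.
case: (boolP (S x)) => [Sx|Sx]; last by left; apply: overloaded_rcons.
right; exists x.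
have xw : x = w1 \/ x = w2 by move/orP: Sx => [/eqP ->|/eqP ->]; [left|right].
have xy : y != x.
  by rewrite /y; case: ifPn => [/eqP ->|]; rewrite eq_sym.
split.
- by case: xw => ->; lia.
- rewrite online_count_rcons /= eqxx /= addn1 ltnS.
  by case: xw => ->.
- move=> t; rewrite offline_count_rcons /= (negPf xy) addn0.
  by case: xw => ->.
- move=> t i ci; rewrite offline_count_rcons /= out2 ?out1; try by lia.
  case: eqP => [iy|_] //=; rewrite ?addn0 //.
  by move: ci; rewrite -iy; case: yw => ->; lia.
- move=> t i; rewrite online_count_rcons; apply: leq_trans (leq_addr _ _).
  exact: leq_trans (mono1 _ _) (mono2 _ _).
Qed.

Lemma tournament_game (R : realType) (m : nat) (A : online_algorithm R m)
    (ok : R -> nat -> Prop) (k : nat) :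
  ok 1 1%N -> (2 ^ k <= m)%N ->
  exists h, [/\ transcript A ok h,
    (forall t (i : 'I_m), (offline_count h t i <= (i < 2 ^ k))%N) &
    overloaded h 1 \/ exists i, (k < online_count h 1 i)%N].
Proof.
move=> ok1 km; have [h [trh arr off [ovl|[w [cw onl offw _ _]]]]] :=
  @tournament R m A ok (2 ^ k) k 0 [::] ok1 km (leqnn _) (TranscriptNil _ _) isT
    (fun _ _ => leq0n _) (fun _ _ _ => erefl).
  by exists h; split=> //; left.
(* The champion is empty offline, so a last job allowed only there keeps the offline load at one and
   raises the online count to [k + 1]. *)
pose S := pred1 w; pose j := unit_job_on S 0 (1 : R) 1.
exists (rcons h (Move j (answer A h j) w)); split.
- by apply: transcript_rcons => //; rewrite /S /= eqxx.
- move=> t i; rewrite offline_count_rcons /=; case: eqP => [<-|_]; last by rewrite addn0.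
  by rewrite offw add0n; apply: leq_trans (leq_b1 _) _; rewrite lt0b; lia.
case: (boolP (S (answer A h j))) => [/eqP Sx|Sx]; last first.
  by left; apply: overloaded_rcons.
by right; exists w; rewrite online_count_rcons /= Sx eqxx /= addn1 ltnS.
Qed.

(** * From transcripts to instances and machine loads *)

Lemma transcript_nth (R : realType) (m : nat) (A : online_algorithm R m)
    (ok : R -> nat -> Prop) (h : seq (move R m)) (e0 : move R m) k :
  transcript A ok h -> (k < size h)%N ->
  [/\ online (nth e0 h k) = answer A (take k h) (mjob (nth e0 h k)),
      unit_job ok (mjob (nth e0 h k)) &
      load (mjob (nth e0 h k)) (offline (nth e0 h k)) = 1%E].
Proof.
move=> trh; elim: trh k => // {}h j y trh IH uj ly arr k.
rewrite size_rcons ltnS leq_eqVlt nth_rcons => /orP[/eqP ->|kh].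
  by rewrite ltnn eqxx -cats1 take_size_cat.
by rewrite kh -cats1 takel_cat 1?ltnW //; apply: IH.
Qed.

Lemma transcript_sorted (R : realType) (m : nat) (A : online_algorithm R m)
    (ok : R -> nat -> Prop) (h : seq (move R m)) :
  transcript A ok h ->
  sorted (fun j k : job R m => (arrival j <= arrival k)%N) (map (@mjob R m) h).
Proof.
elim=> // {}h j y trh IH uj ly arr; rewrite map_rcons.
case/lastP: h {trh} IH arr => // h e IH; rewrite all_rcons => /andP[le _].
move: IH; rewrite map_rcons; case: (map _ h) => [|j0 s] /=; first by rewrite le.
by move=> IH; rewrite rcons_path IH last_rcons le.
Qed.

Lemma machine_load_moves (R : realType) (m : nat) (h : seq (move R m))
    (e0 : move R m) (g : move R m -> 'I_m)
    (b : assignment (map (@mjob R m) h)) t i :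
  (forall k, b k = g (nth e0 h k)) ->
  machine_load b t i =
  (\sum_(e <- h | (g e == i) && alive (mjob e) t) load (mjob e) i)%E.
Proof.
move=> bE; rewrite /machine_load (big_nth e0) -(size_map (@mjob R m) h) big_mkord.
have jE k : job_at (map (@mjob R m) h) k = mjob (nth e0 h k).
  rewrite /job_at (tnth_nth (mjob e0)) /= (nth_map e0) //.
  by rewrite -(size_map (@mjob R m) h).
by apply: eq_big => [k|k _]; rewrite ?bE jE.
Qed.

Lemma run_moves (R : realType) (m : nat) (A : online_algorithm R m)
    (h : seq (move R m)) (e0 : move R m) :
  (forall k, (k < size h)%N ->
    online (nth e0 h k) = answer A (take k h) (mjob (nth e0 h k))) ->
  forall k, run A (map (@mjob R m) h) k = online (nth e0 h k).
Proof.
move=> hA k; have kh : (k < size h)%N by rewrite -(size_map (@mjob R m) h).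
rewrite ffunE hA // /answer /job_at (tnth_nth (mjob e0)) /= (nth_map e0) //.
by rewrite -map_take -map_comp.
Qed.

Lemma unit_load_ge1 (R : realType) (m : nat) (S : pred 'I_m) i :
  (1 <= unit_load R S i)%E.
Proof. by rewrite /unit_load; case: ifP => // _; rewrite leey. Qed.

(** Only an inequality, since a job on a forbidden machine contributes [+oo] instead of [1]. *)
Lemma online_load_ge (R : realType) (m : nat) (A : online_algorithm R m)
    (ok : R -> nat -> Prop) (h : seq (move R m)) t i :
  transcript A ok h ->
  ((online_count h t i)%:R%:E <=
   \sum_(e <- h | (online e == i) && alive (mjob e) t) load (mjob e) i)%E.
Proof.
elim=> [|{}h j y trh IH uj ly arr]; first by rewrite big_nil.
rewrite online_count_rcons -cats1 big_cat big_cons big_nil /= natrD EFinD.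
apply: leeD IH _; have [[S ->] _] := uj.
by case: ifP => _ //; rewrite adde0 unit_load_ge1.
Qed.

Lemma overloaded_load (R : realType) (m : nat) (A : online_algorithm R m)
    (ok : R -> nat -> Prop) (h : seq (move R m)) t :
  transcript A ok h -> overloaded h t ->
  exists i, (\sum_(e <- h | (online e == i) && alive (mjob e) t)
               load (mjob e) i = +oo)%E.
Proof.
elim=> // {}h j y trh IH uj ly arr; rewrite /overloaded has_rcons => /orP[|/IH[i iE]].
  move=> /andP[/= al /eqP lE]; exists (answer A h j).
  rewrite -cats1 big_cat big_cons big_nil /= eqxx al lE adde0 addey //.
  rewrite -ltNye; apply: lt_le_trans (online_load_ge _ _ trh).
  by rewrite ltNyr.
exists i; rewrite -cats1 big_cat big_cons big_nil /= iE addye //.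
case: ifP => // _; rewrite adde0 -ltNye; apply: (lt_le_trans (ltNyr 1)).
by have [[S ->] _] := uj; exact: unit_load_ge1.
Qed.

Lemma offline_load_count (R : realType) (m : nat) (A : online_algorithm R m)
    (ok : R -> nat -> Prop) (h : seq (move R m)) t i :
  transcript A ok h ->
  (\sum_(e <- h | (offline e == i) && alive (mjob e) t) load (mjob e) i =
   (offline_count h t i)%:R%:E)%E.
Proof.
elim=> [|{}h j y trh IH uj ly arr]; first by rewrite big_nil.
rewrite offline_count_rcons -cats1 big_cat big_cons big_nil /= natrD EFinD IH.
by congr (_ + _)%E; case: eqP => [<-|] //=; case: ifP => //; rewrite ly adde0.
Qed.

(** * Norms of integer load vectors *)

Lemma ler_lpnorm (R : realType) (m : nat) (p : R) (v w : 'I_m -> \bar R) :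
  0 <= p -> (forall i, 0 <= v i)%E -> (forall i, v i <= w i)%E ->
  (lpnorm p v <= lpnorm p w)%E.
Proof.
move=> p0 v0 vw; have w0 i : (0 <= w i)%E := le_trans (v0 i) (vw i).
apply: gt0_ler_poweR; rewrite ?invr_ge0 ?in_itv /= ?andbT ?leey //;
  try by rewrite sume_ge0 // => i _; exact: poweR_ge0.
apply: lee_sum => i _; apply: gt0_ler_poweR; rewrite ?in_itv /= ?abse_ge0 ?leey //.
by rewrite !gee0_abs.
Qed.

Lemma lpnorm_nat (R : realType) (m : nat) (p : R) (c : 'I_m -> nat) :
  lpnorm p (fun i => (c i)%:R%:E) =
  ((\sum_(i < m) (c i)%:R `^ p) `^ p^-1)%:E.
Proof.
rewrite /lpnorm -poweR_EFin -sumEFin; congr (_ `^ _)%E.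
by apply: eq_bigr => i _; rewrite abse_EFin normr_nat poweR_EFin.
Qed.

Lemma lpnorm_pinfty (R : realType) (m : nat) (p : R) (v : 'I_m -> \bar R) i :
  0 < p -> v i = +oo%E -> lpnorm p v = +oo%E.
Proof.
move=> p0 vi; rewrite /lpnorm (bigD1 i) //=.
have -> : (`|v i| `^ p = +oo)%E by rewrite vi poweRyr ?gt_eqF.
rewrite addye; first by rewrite poweRyr // invr_eq0 gt_eqF.
by rewrite -ltNye (lt_le_trans ltNy0) // sume_ge0 // => k _; exact: poweR_ge0.
Qed.

Lemma powRK (R : realType) (p x : R) : p != 0 -> 0 <= x -> (x `^ p) `^ p^-1 = x.
Proof. by move=> p0 x0; rewrite -powRrM mulfV // powRr1. Qed.

Lemma lpnorm_nat_ge_coord (R : realType) (m : nat) (p : R) (c : 'I_m -> nat) i k :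
  0 < p -> (k <= c i)%N -> (k%:R%:E <= lpnorm p (fun i => (c i)%:R%:E))%E.
Proof.
move=> p0 kc; rewrite lpnorm_nat lee_fin -[leLHS](@powRK _ p) ?gt_eqF //.
apply: ge0_ler_powR; rewrite ?invr_ge0 ?nnegrE ?powR_ge0 ?(ltW p0) //.
  by apply: sumr_ge0 => k' _; exact: powR_ge0.
rewrite (bigD1 i) //= -[leLHS]addr0 lerD //; last first.
  by apply: sumr_ge0 => k' _; exact: powR_ge0.
by apply: ge0_ler_powR; rewrite ?nnegrE ?ler_nat ?(ltW p0).
Qed.

Lemma lpnorm_nat_le (R : realType) (m : nat) (p : R) (c : 'I_m -> nat) N :
  0 < p -> (N <= m)%N -> (forall i, (c i <= (i < N))%N) ->
  (lpnorm p (fun i => (c i)%:R%:E) <= (N%:R `^ p^-1)%:E)%E.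
Proof.
move=> p0 Nm cN; rewrite lpnorm_nat lee_fin.
apply: ge0_ler_powR; rewrite ?invr_ge0 ?nnegrE ?(ltW p0) //.
  by apply: sumr_ge0 => k' _; exact: powR_ge0.
apply: (@le_trans _ _ (\sum_(i < m) (i < N)%:R)); last first.
  rewrite -natr_sum ler_nat (eq_bigr (fun i : 'I_m => if (i < N)%N then 1 else 0)%N).
    by rewrite -big_mkcond /= -(big_ord_widen m (fun _ => 1%N) Nm) sum1_card card_ord.
  by move=> i _; case: ltnP.
apply: ler_sum => i _; move: (cN i); case: (i < N)%N; case: (c i) => [|[|//]] //=.
- by rewrite powR0 ?gt_eqF.
- by rewrite powR1.
- by rewrite powR0 ?gt_eqF.
Qed.

(* The tangent of [x `^ p] at [y] lies below the graph.                        *)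
Lemma powR_tangent (R : realType) (p x y : R) :
  1 <= p -> 0 <= x -> 0 <= y ->
  p * (x * y `^ (p - 1)) <= x `^ p + (p - 1) * y `^ p.
Proof.
rewrite le_eqVlt => /orP[/eqP <-|p1] x0 y0.
  by rewrite subrr powRr0 powRr1 // mul0r addr0 mulr1 mul1r.
have p0 : 0 < p by lra.
have p10 : 0 < p - 1 by lra.
(* Young's inequality for [x] and [y^(p-1)] with the conjugate exponents [p] and [p / (p - 1)]. *)
have := @conjugate_powR R x (y `^ (p - 1)) p (p / (p - 1)) x0 (powR_ge0 _ _).
rewrite -powRrM (mulrC (p - 1)) divfK ?gt_eqF // => /(_ p0 _ _) H.
have {H} := H (divr_gt0 p0 p10).
rewrite (_ : p^-1 + (p / (p - 1))^-1 = 1); last first.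
  by rewrite invf_div; field; rewrite gt_eqF.
move=> /(_ erefl) H.
rewrite -ler_pdivlMl //; apply: le_trans H _.
by rewrite mulrDr invf_div mulrC lerD2l mulrCA mulrA mulrC.
Qed.

(** Sums [powR_tangent] over [P] at the point [s / a]. *)
Lemma power_mean (R : realType) (I : finType) (P : pred I) (p : R) (x : I -> R)
    (s : R) (a : nat) :
  1 <= p -> (forall i, 0 <= x i) -> #|P| = a -> (0 < a)%N -> 0 <= s ->
  s <= \sum_(i | P i) x i -> a%:R * (s / a%:R) `^ p <= \sum_(i | P i) x i `^ p.
Proof.
move=> p1 x0 Pa a0 s0 sx; pose y := s / a%:R.
have aR : 0 < a%:R :> R by rewrite ltr0n.
have y0 : 0 <= y by rewrite divr_ge0 // ltW.
have p0 : 0 < p by lra.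
have : \sum_(i | P i) (p * (x i * y `^ (p - 1))) <=
       \sum_(i | P i) (x i `^ p + (p - 1) * y `^ p).
  by apply: ler_sum => i _; exact: powR_tangent.
rewrite -mulr_sumr -mulr_suml big_split /= sumr_const Pa -/y.
have : p * (s * y `^ (p - 1)) <= p * ((\sum_(i | P i) x i) * y `^ (p - 1)).
  by rewrite ler_pM2l // ler_wpM2r // powR_ge0.
have -> : s = a%:R * y by rewrite /y mulrC divfK ?gt_eqF.
rewrite -mulrA mulr_powRB1 // -mulr_natl => H1 H2.
have {H1 H2} := le_trans H1 H2.
set Z := y `^ p; set X := \sum_(i | P i) _; rewrite -subr_ge0 => H.
rewrite -subr_ge0; apply: le_trans H _; rewrite le_eqVlt; apply/orP; left.
by apply/eqP; ring.
Qed.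

(** By convexity [n] jobs on [a] machines are cheapest when spread evenly, with norm
    [a^(1/p) * (n / a)]. *)
Lemma lpnorm_nat_ge_sum (R : realType) (m : nat) (p : R) (c : 'I_m -> nat) a n :
  1 <= p -> (0 < a)%N -> (a <= m)%N -> (n <= \sum_(i < m | i < a) c i)%N ->
  ((n%:R * a%:R `^ (p^-1 - 1))%:E <= lpnorm p (fun i => (c i)%:R%:E))%E.
Proof.
move=> p1 a0 am nc; rewrite lpnorm_nat lee_fin; have p0 : 0 < p by lra.
have aR : 0 < a%:R :> R by rewrite ltr0n.
have -> : n%:R * a%:R `^ (p^-1 - 1) =
    (a%:R * (n%:R / a%:R) `^ p) `^ p^-1 :> R.
  rewrite powRM ?powR_ge0 ?(ltW aR) // powRK ?gt_eqF ?divr_ge0 ?(ltW aR) //.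
  rewrite powRB; last by rewrite (lt0r_neq0 aR) implybT.
  by rewrite powRr1 ?(ltW aR) // mulrCA.
apply: ge0_ler_powR; rewrite ?invr_ge0 ?nnegrE ?(ltW p0) //.
  by apply: sumr_ge0 => k' _; exact: powR_ge0.
apply: (@le_trans _ _ (\sum_(i < m | (i < a)%N) (c i)%:R `^ p)).
  apply: power_mean => //; last by rewrite -natr_sum ler_nat.
  by rewrite -sum1_card -(big_ord_widen m (fun _ => 1%N) am) sum1_card card_ord.
rewrite [leRHS](bigID (fun i : 'I_m => (i < a)%N)) /= lerDl.
by apply: sumr_ge0 => k' _; exact: powR_ge0.
Qed.

(** * From a game to a bound on the competitive ratio *)

(** The predicate [ok] for which games yield legal inputs; [e <= D] keeps [D] the maximum
    estimate. *)
Definition admissible (R : realType) (mu1 mu2 D e : R) (d : nat) : Prop :=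
  [/\ (1 <= d)%N, 1 <= e, e <= D &
      Num.ceil (e / mu2) <= d%:Z <= Num.floor (mu1 * e)].

(* A first job of load 0 makes the maximum estimate equal to [D] without       *)
(* affecting the loads.                                                        *)
Definition null_job (R : realType) (m : nat) (D : R) (d : nat) : job R m :=
  Job 0 (fun=> 0%E) D d.

(** The algorithm as it behaves once the null job has been presented, so that transcripts need not
    contain that job. *)
Definition after_null_job (R : realType) (m : nat) (A : online_algorithm R m)
    (D : R) (d : nat) : online_algorithm R m :=
  fun obs ann => A (observe (ann_arrival ann) (null_job m D d) :: obs) ann.

Lemma lee_div_bounds (R : realType) (v w : R) (x y : \bar R) :
  0 < w -> (0 <= x)%E -> (0 <= y)%E -> (v%:E <= x)%E -> (y <= w%:E)%E ->
  ((v / w)%:E <= x / y)%E.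
Proof.
move=> w0 x0 y0 vx yw; apply: (@le_trans _ _ (x * w^-1%:E)%E).
  by rewrite EFinM lee_wpmul2r // lee_fin invr_ge0 ltW.
apply: lee_pmul => //; first by rewrite lee_fin invr_ge0 ltW.
rewrite (_ : w^-1%:E = w%:E^-1)%E; last by rewrite inver gt_eqF.
by rewrite lee_pV2 // ?inE ?lee_fin ?ltW.
Qed.

Lemma objective_ge0 (R : realType) (m : nat) (N : ('I_m -> \bar R) -> \bar R)
    (s : instance R m) (b : assignment s) :
  (forall v, 0 <= N v)%E -> (0 <= objective N b)%E.
Proof.
move=> N0; apply: le_trans (N0 (machine_load b 0)) _.
by apply: ereal_sup_ubound; exists 0%N.
Qed.

Lemma opt_ge0 (R : realType) (m : nat) (N : ('I_m -> \bar R) -> \bar R)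
    (s : instance R m) : (forall v, 0 <= N v)%E -> (0 <= opt N s)%E.
Proof. by move=> N0; apply: le_ereal_inf_tmp => _ [b _ <-]; exact: objective_ge0. Qed.

Lemma transcript_inputs (R : realType) (m : nat) (M : model) (A : online_algorithm R m)
    (mu1 mu2 D : R) (d : nat) (h : seq (move R m)) :
  1 <= mu1 -> 1 <= mu2 -> admissible mu1 mu2 D D d ->
  transcript A (admissible mu1 mu2 D) h ->
  inputs m M (mu1 * mu2) D (null_job m D d :: map (@mjob R m) h).
Proof.
move=> m1 m2 [d1 D1 _ dD] trh.
have jobs (P : job R m -> Prop) : P (null_job m D d) ->
    (forall j, unit_job (admissible mu1 mu2 D) j -> P j) ->
    forall k, P (job_at (null_job m D d :: map (@mjob R m) h) k).
  move=> Pd Pj k; rewrite /job_at (tnth_nth (null_job m D d)) /=.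
  case: k => -[|k] //=; rewrite ltnS size_map => kh.
  have e0 : move R m by case: h {trh} kh.
  rewrite (nth_map e0) //; apply: Pj.
  by have [] := transcript_nth e0 trh kh.
split.
- have := transcript_sorted trh; case: (map _ h) => //=.
- apply: (jobs (@valid_job R m)) => [|j [[S lj] [? ? ? _]]]; split=> //=.
  by move=> i; rewrite lj (le_trans _ (unit_load_ge1 R S i)).
- case: M => //=; apply: (jobs (@restricted_job R m)) => [|j [[S lj] _]]; first by exists 0 => i; left.
  by exists 1 => i; rewrite lj /unit_load; case: ifP; [left|right].
- exists mu1, mu2; split=> //.
  by apply: (jobs (job_distortion mu1 mu2)) => // j [_ [_ _ _]].
- rewrite /max_estimate big_cons /=; apply/max_idPl.
  have : forall k, estimate (job_at (null_job m D d :: map (@mjob R m) h) k) <= D.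
    by apply: (jobs (fun j => estimate j <= D)) => // j [_ [_ _ + _]].
  move=> est; rewrite (big_nth (null_job m D d)) big_mkord.
  apply: bigmax_le => [|k _]; first by lra.
  have kh : (k.+1 < size (null_job m D d :: map (@mjob R m) h))%N by rewrite /= ltnS.
  by have := est (Ordinal kh); rewrite /job_at (tnth_nth (null_job m D d)).
Qed.

Lemma competitive_ratio_ge (R : realType) (m : nat) (p : R) (M : model)
    (A : online_algorithm R m) (mu1 mu2 D v : R) (d N t : nat)
    (h : seq (move R m)) :
  1 <= p -> 1 <= mu1 -> 1 <= mu2 -> admissible mu1 mu2 D D d ->
  (0 < N <= m)%N ->
  transcript (after_null_job A D d) (admissible mu1 mu2 D) h ->
  (forall u i, (offline_count h u i <= (i < N))%N) ->
  overloaded h t \/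
    (v%:E <= lpnorm p (fun i => (online_count h t i)%:R%:E))%E ->
  ((v / N%:R `^ p^-1)%:E
   <= competitive_ratio (lpnorm p) A (inputs m M (mu1 * mu2) D))%E.
Proof.
move=> p1 m1 m2 admD /andP[N0 Nm] trh off onl; have p0 : 0 < p by lra.
pose j0 := null_job m D d; pose e0 := Move j0 (answer A [::] j0) (answer A [::] j0).
have norm0 (w : 'I_m -> \bar R) : (0 <= lpnorm p w)%E by exact: poweR_ge0.
pose s := map (@mjob R m) (e0 :: h).
have loadE (g : move R m -> 'I_m) u i :
    (\sum_(e <- e0 :: h | (g e == i) && alive (mjob e) u) load (mjob e) i =
     \sum_(e <- h | (g e == i) && alive (mjob e) u) load (mjob e) i)%E.
  by rewrite big_cons /=; case: ifP; rewrite ?add0e.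
apply: (@le_trans _ _ (objective (lpnorm p) (run A s) / opt (lpnorm p) s)%E); last first.
  apply: ereal_sup_ubound; exists s => //.
  exact: (transcript_inputs M m1 m2 admD trh).
apply: lee_div_bounds; rewrite ?powR_gt0 ?ltr0n ?objective_ge0 ?opt_ge0 //.
- apply: (@le_trans _ _ (lpnorm p (machine_load (run A s) t))); last first.
    by apply: ereal_sup_ubound; exists t.
  have runE k : run A s k = online (nth e0 (e0 :: h) k).
    apply: run_moves => -[|k'] //= kh; have [-> _ _] := transcript_nth e0 trh kh.
    by [].
  have mlE i := machine_load_moves t i runE.
  case: onl => [ovl|onl].
    have [i iE] := overloaded_load trh ovl.
    by rewrite (lpnorm_pinfty p0 (i := i)) ?leey // mlE loadE.
  apply: le_trans onl _; apply: ler_lpnorm => [|i|i]; rewrite ?(ltW p0) ?lee_fin //.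
  by rewrite mlE loadE; exact: online_load_ge trh.
pose o : assignment s := [ffun k : 'I_(size s) => offline (nth e0 (e0 :: h) k)].
have mlE u i : machine_load o u i = ((offline_count h u i)%:R%:E)%E.
  rewrite (@machine_load_moves _ _ _ e0 (@offline R m)) => [|k]; last by rewrite ffunE.
  by rewrite loadE (offline_load_count _ _ trh).
apply: (@le_trans _ _ (objective (lpnorm p) o)).
  by apply: ereal_inf_lbound; exists o.
apply: ge_ereal_sup => _ [u _ <-].
apply: le_trans (lpnorm_nat_le p0 Nm (off u)).
by apply: ler_lpnorm => [|i|i]; rewrite ?(ltW p0) ?mlE ?lee_fin.
Qed.

(** Nonemptiness supplies a splitting of [mu] and an integer duration that is legal for the estimate
    [D], as the null job requires. *)
Lemma inputs_admissible (R : realType) (m : nat) (M : model) (mu D : R) :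
  1 <= D -> inputs m M mu D !=set0 ->
  exists mu1 mu2 d, [/\ 1 <= mu1, 1 <= mu2, mu1 * mu2 = mu &
    admissible mu1 mu2 D D d].
Proof.
move=> D1 [s [_ valid _ [mu1 [mu2 [m1 m2 mE dist]]] maxE]].
have [k kE] : exists k, estimate (job_at s k) = D.
  apply/not_existsP => neD; have : max_estimate s < D.
    rewrite /max_estimate big_tnth; apply: bigmax_lt => [|k _]; first by lra.
    rewrite lt_neqAle; apply/andP; split; first by apply/eqP; exact: neD.
    by rewrite -maxE /max_estimate big_tnth; exact: le_bigmax.
  by rewrite maxE ltxx.
exists mu1, mu2, (duration (job_at s k)); split=> //.
have [? _ _] := valid k; split=> //; rewrite -kE; exact: dist.
Qed.

Lemma admissible_exact (R : realType) (mu1 mu2 D : R) (d : nat) :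
  1 <= mu1 -> 1 <= mu2 -> (0 < d)%N -> d%:R <= D -> admissible mu1 mu2 D d%:R d.
Proof.
move=> m1 m2 d0 dD; split=> //; first by rewrite ler1n.
rewrite ceil_le_int floor_ge_int; apply/andP; split.
  by rewrite ler_pdivrMr ?(lt_le_trans ltr01) // ler_peMr.
by rewrite ler_peMl.
Qed.

Lemma admissible_short (R : realType) (mu D : R) (d : nat) :
  1 <= D -> (0 < d)%N -> d%:R <= mu -> admissible mu 1 D 1 d.
Proof.
move=> D1 d0 dmu; split=> //; rewrite divr1 mulr1 ceil_le_int floor_ge_int.
by apply/andP; split=> //; rewrite ler1n.
Qed.

(** The first integer above [D] is at most [D + 1 <= 2 * D <= mu * D]. *)
Lemma admissible_max (R : realType) (mu D : R) :
  2 <= mu -> 1 <= D -> exists d, admissible mu 1 D D d.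
Proof.
move=> mu2 D1; exists (Num.truncn D).+1; split=> //.
have /andP[tD Dt] := truncn_itv (le_trans ler01 D1).
rewrite divr1 ceil_le_int floor_ge_int; apply/andP; split; first exact: ltW.
rewrite -pmulrn -natr1; apply: (@le_trans _ _ (2 * D)); first by lra.
by rewrite ler_pM2r //; lra.
Qed.

(** * Ratios forced by the games *)

Lemma tournament_ratio (R : realType) (m : nat) (p mu D : R) (M : model)
    (A : online_algorithm R m) (k : nat) :
  1 <= p -> 1 <= D -> inputs m GeneralLoads mu D !=set0 -> (2 ^ k <= m)%N ->
  ((k.+1%:R / (2 ^ k)%:R `^ p^-1)%:E
   <= competitive_ratio (lpnorm p) A (inputs m M mu D))%E.
Proof.
move=> p1 D1 /(inputs_admissible D1)[mu1 [mu2 [d [m1 m2 <- admD]]]] km.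
have [|//|h [trh off onl]] := @tournament_game R m (after_null_job A D d)
  (admissible mu1 mu2 D) k.
  exact: (admissible_exact (d := 1)).
apply: (competitive_ratio_ge (t := 1) _ p1 m1 m2 admD _ trh off).
  by rewrite expn_gt0 km.
case: onl => [?|[i ki]]; [by left|right].
by apply: lpnorm_nat_ge_coord ki; lra.
Qed.

Lemma window_ratio (R : realType) (m : nat) (p mu1 mu2 D : R) (M : model)
    (A : online_algorithm R m) (d a n : nat) (v : R) (h : seq (move R m)) :
  1 <= p -> 1 <= mu1 -> 1 <= mu2 -> admissible mu1 mu2 D D d ->
  (0 < a)%N -> (a + n <= m)%N ->
  v <= a%:R -> v <= n%:R * a%:R `^ (p^-1 - 1) ->
  window_outcome (after_null_job A D d) (admissible mu1 mu2 D) a n h ->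
  ((v / (a + n)%:R `^ p^-1)%:E
   <= competitive_ratio (lpnorm p) A (inputs m M (mu1 * mu2) D))%E.
Proof.
move=> p1 m1 m2 admD a0 anm va vn [trh off [t onl]].
apply: (competitive_ratio_ge (t := t) _ p1 m1 m2 admD _ trh off).
  by rewrite anm addn_gt0 a0.
case: onl => [?|[i ai]|sn]; [by left|right|right].
  apply: (@le_trans _ _ a%:R%:E); first by rewrite lee_fin.
  by apply: lpnorm_nat_ge_coord ai; lra.
apply: (@le_trans _ _ (n%:R * a%:R `^ (p^-1 - 1))%:E); first by rewrite lee_fin.
apply: lpnorm_nat_ge_sum => //; exact: leq_trans (leq_addr _ _) anm.
Qed.

Lemma distortion_ratio (R : realType) (m : nat) (p mu D : R) (M : model)
    (A : online_algorithm R m) (a n : nat) (v : R) :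
  1 <= p -> 2 <= mu -> 1 <= D -> (0 < a)%N -> (a + n <= m)%N -> n.+1%:R <= mu ->
  v <= a%:R -> v <= n%:R * a%:R `^ (p^-1 - 1) ->
  ((v / (a + n)%:R `^ p^-1)%:E
   <= competitive_ratio (lpnorm p) A (inputs m M mu D))%E.
Proof.
move=> p1 mu2 D1 a0 anm nmu va vn; have [d admD] := admissible_max mu2 D1.
have mu1 : 1 <= mu by lra.
(* All estimates are [1] and [mu1 = mu] carries the whole distortion. Steps are one slot apart, so
   short jobs last one slot and long ones [k + 2 <= n + 1 <= mu]. *)
have [//|||||||h out] := @window_game R m (after_null_job A D d)
  (admissible mu 1 D) a n (fun k => k.+1) (fun _ _ => 1%N) (fun _ _ => 1%N)
  (fun k _ => k.+2) (fun _ _ => 1) anm; try by [].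
- by move=> *; exact: admissible_short.
- move=> k r kn _; apply: admissible_short => //.
  by apply: le_trans nmu; rewrite ler_nat.
by rewrite -[mu]mulr1; exact: window_ratio out.
Qed.

Lemma duration_ratio (R : realType) (m : nat) (p mu D : R) (M : model)
    (A : online_algorithm R m) (a n : nat) (v : R) :
  1 <= p -> 1 <= D -> inputs m GeneralLoads mu D !=set0 ->
  (0 < a)%N -> (a + n <= m)%N -> a%:R ^+ n <= D ->
  v <= a%:R -> v <= n%:R * a%:R `^ (p^-1 - 1) ->
  ((v / (a + n)%:R `^ p^-1)%:E
   <= competitive_ratio (lpnorm p) A (inputs m M mu D))%E.
Proof.
move=> p1 D1 /(inputs_admissible D1)[mu1 [mu2 [d [m1 m2 <- admD]]]].
move=> a0 anm aD va vn.
have ak k : (0 < a ^ k)%N by rewrite expn_gt0 a0.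
have adm k r : (k < n)%N -> (r < a)%N ->
    admissible mu1 mu2 D (r.+1 * a ^ k)%:R (r.+1 * a ^ k).
  move=> kn ra; apply: admissible_exact; rewrite ?muln_gt0 ?ak //.
  apply: le_trans aD; rewrite -natrX ler_nat.
  apply: (@leq_trans (a ^ k.+1)); last by rewrite leq_pexp2l.
  by rewrite expnS leq_mul2r ra orbT.
(* Estimates are exact, so short and long durations agree: by the time [r * a ^ k] after the start
   of the step, all its earlier jobs are over, and job [r] lasts for a further [a ^ k] slots. *)
have [//|//|k r|k r r' r'r ra|k r|k r ra|h out] := @window_game R m (after_null_job A D d)
  (admissible mu1 mu2 D) a n (fun k => a ^ k)%N (fun k r => r * a ^ k)%N
  (fun k r => r.+1 * a ^ k)%N (fun k r => r.+1 * a ^ k)%N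
  (fun k r => (r.+1 * a ^ k)%:R) anm ak.
- by rewrite muln_gt0 /=.
- by rewrite leq_mul2r r'r orbT.
- by rewrite mulSn addnC.
- by rewrite addnC -mulSn expnS leq_mul2r ra orbT.
exact: window_ratio out.
Qed.

(** * Choice of the parameters *)

Lemma powR_lep (R : realType) (x y r : R) :
  0 <= r -> 0 <= x -> x <= y -> x `^ r <= y `^ r.
Proof.
by move=> r0 x0 xy; apply: ge0_ler_powR; rewrite ?nnegrE // (le_trans x0).
Qed.

Lemma exponent_bounds (R : realType) (p : R) : 1 <= p ->
  0 <= p / (2 * p - 1) - 1 / p <= 1 /\ 2^-1 <= p / (2 * p - 1) <= 1.
Proof.
move=> p1; have q0 : 0 < 2 * p - 1 by lra.
have e1 : p / (2 * p - 1) <= 1 by rewrite ler_pdivrMr //; lra.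
have e2 : 2^-1 <= p / (2 * p - 1) by rewrite ler_pdivlMr //; lra.
have pV : 0 <= 1 / p by apply: divr_ge0; lra.
split; last by rewrite e1 e2.
apply/andP; split; last by lra.
have -> : p / (2 * p - 1) - 1 / p = (p - 1) ^+ 2 / (p * (2 * p - 1)).
  by field; apply/andP; split; rewrite gt_eqF //; lra.
by apply: divr_ge0; [exact: sqr_ge0|apply: mulr_ge0; lra].
Qed.

(* Balances the two outcomes of the window game: [a] is about [n `^ e] with    *)
(* [e = p / (2 p - 1)], the solution of [n `^ e = n * (n `^ e) `^ (1/p - 1)].  *)
Lemma window_parameters (R : realType) (p Y : R) : 1 <= p -> 2 <= Y ->
  exists a n v, [/\ (0 < a <= n)%N, n.*2%:R <= Y, v <= a%:R,
    v <= n%:R * a%:R `^ (p^-1 - 1) &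
    Y `^ (p / (2 * p - 1) - 1 / p) / 16 <= v / (a + n)%:R `^ p^-1 :> R].
Proof.
move=> p1 Y2; have [/andP[ep0 ep1] /andP[e2 e1]] := exponent_bounds p1.
set ep := _ - 1 / p in ep0 ep1 *; set e := p / (2 * p - 1) in e1 e2 ep ep0 ep1 *.
have p0 : 0 < p by lra.
have q0 : 0 < 2 * p - 1 by lra.
have pV0 : 0 < p^-1 by rewrite invr_gt0.
have pV1 : p^-1 <= 1 by rewrite invf_le1.
(* As [n >= 1], rounding down still leaves [Y / 4 <= n]. *)
pose n := Num.truncn (Y / 2).
have /andP[nY Yn] : n%:R <= Y / 2 < n.+1%:R by apply: truncn_itv; lra.
have n1 : 1 <= n%:R :> R.
  by rewrite ler1n -ltnS -(ltr_nat R); lra.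
rewrite -[n.+1%:R]natr1 in Yn.
have n0 : 0 < n%:R :> R by lra.
pose x : R := n%:R `^ e.
have x1 : 1 <= x by rewrite -[leLHS](powRr0 n%:R) ler_powR //; lra.
have x0 : 0 < x by lra.
have xn : x <= n%:R by rewrite /x ler1_powR.
pose a := Num.truncn x.
have /andP[ax xa] : a%:R <= x < a.+1%:R by apply: truncn_itv; lra.
have a1 : 1 <= a%:R :> R.
  by rewrite ler1n -ltnS -(ltr_nat R); lra.
rewrite -natr1 in xa.
have a0 : 0 < a%:R :> R by lra.
have an : a%:R <= n%:R :> R by lra.
(* Halving absorbs the rounding of [x]: [x < a + 1 <= 2 * a]. *)
exists a, n, (x / 2); split.
- by apply/andP; split; [rewrite -(ltr_nat R)|rewrite -(ler_nat R)].
- by rewrite -muln2 natrM; lra.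
- by lra.
- have -> : p^-1 - 1 = - (1 - p^-1) by ring.
  rewrite powRN; apply: (@le_trans _ _ x); first by lra.
  have -> : x = n%:R / x `^ (1 - p^-1).
    rewrite /x -powRrM -[X in X / _](@powRr1 _ n%:R) ?ltW // -powRB; last first.
      by rewrite (lt0r_neq0 n0) implybT.
    congr (_ `^ _); rewrite /e; field.
    by rewrite !gt_eqF.
  rewrite ler_pM2l // lef_pV2 ?posrE ?powR_gt0 //.
  by apply: powR_lep; lra.
have anp : (a + n)%:R `^ p^-1 <= 2 * n%:R `^ p^-1 :> R.
  apply: (@le_trans _ _ ((2 * n%:R) `^ p^-1)).
    by apply: powR_lep; rewrite ?(ltW pV0) // natrD; lra.
  rewrite powRM ?(ltW n0) // ler_pM2r ?powR_gt0 //.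
  by rewrite ler1_powR //; lra.
apply: (@le_trans _ _ (x / 2 / (2 * n%:R `^ p^-1))); last first.
  rewrite ler_pM2l; last by lra.
  have an0 : 0 < (a + n)%:R :> R by rewrite natrD; lra.
  by rewrite lef_pV2 ?posrE ?mulr_gt0 ?powR_gt0.
have -> : x / 2 / (2 * n%:R `^ p^-1) = n%:R `^ ep / 4.
  rewrite /ep div1r powRB; last by rewrite (lt0r_neq0 n0) implybT.
  by rewrite -/x; field; rewrite gt_eqF // powR_gt0.
(* With [4^ep <= 4], the bound [n^ep / 4] is at least [Y^ep / 16]. *)
have : (Y / 4) `^ ep <= n%:R `^ ep by apply: powR_lep => //; lra.
have -> : Y `^ ep = (Y / 4) `^ ep * 4 `^ ep.
  by rewrite -powRM ?divfK //; lra.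
have : 4 `^ ep <= 4 :> R by rewrite ler1_powR //; lra.
have : 0 <= (Y / 4) `^ ep := powR_ge0 _ _.
set s := (Y / 4) `^ ep; set f := 4 `^ ep; move=> s0 f4 sn.
have : s * f <= s * 4 by rewrite ler_wpM2l.
by lra.
Qed.

(** * Estimates for logarithms *)

Lemma ln2_gt0 (R : realType) : 0 < ln 2 :> R.
Proof. by rewrite ln_gt0 // ltr1n. Qed.

Lemma ler_log2 (R : realType) (x y : R) : 0 < x -> x <= y -> log2 x <= log2 y.
Proof.
move=> x0 xy; rewrite /log2 ler_pM2r ?invr_gt0 ?ln2_gt0 //.
by rewrite ler_ln ?posrE // (lt_le_trans x0).
Qed.

Lemma log2X (R : realType) (x : R) n : 0 < x -> log2 (x ^+ n) = n%:R * log2 x.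
Proof. by move=> x0; rewrite /log2 lnXn // mulrA mulr_natl. Qed.

Lemma log2_2 (R : realType) : log2 2 = 1 :> R.
Proof. by rewrite /log2 divff // gt_eqF // ln2_gt0. Qed.

Lemma log2_1 (R : realType) : log2 1 = 0 :> R.
Proof. by rewrite /log2 ln1 mul0r. Qed.

Lemma log2_ge0 (R : realType) (x : R) : 1 <= x -> 0 <= log2 x.
Proof. by move=> x1; rewrite -(log2_1 R) ler_log2. Qed.

Lemma le_of_log2 (R : realType) (x y : R) :
  0 < x -> 0 < y -> log2 x <= log2 y -> x <= y.
Proof.
move=> x0 y0; rewrite /log2 ler_pM2r ?invr_gt0 ?ln2_gt0 //.
by rewrite ler_ln.
Qed.

Lemma log_over_loglog_ge0 (R : realType) (D : R) : 1 <= D -> 0 <= log_over_loglog D.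
Proof.
move=> D1; apply: divr_ge0; first exact: log2_ge0.
by rewrite le_max ler01.
Qed.

Lemma log_over_loglog_le (R : realType) (D : R) : 1 <= D ->
  log_over_loglog D <= log2 D.
Proof.
move=> D1; have L1 : 1 <= Num.max 1 (log2 (log2 D)) by rewrite le_max lexx.
by rewrite ler_pdivrMr ?(lt_le_trans ltr01) // ler_peMr // log2_ge0.
Qed.

(** If [log2 D > m], then [log2 D <= m * log2 m <= m * log2 (log2 D)]. *)
Lemma log_over_loglog_le_machines (R : realType) (m : nat) (D : R) :
  1 <= D -> D <= m%:R ^+ m -> (0 < m)%N -> log_over_loglog D <= m%:R.
Proof.
move=> D1 Dm m0; have mR : 0 < m%:R :> R by rewrite ltr0n.
have [Ym|mY] := leP (log2 D) m%:R.
  exact: le_trans (log_over_loglog_le D1) Ym.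
have L1 : 1 <= Num.max 1 (log2 (log2 D)) by rewrite le_max lexx.
rewrite ler_pdivrMr ?(lt_le_trans ltr01) //.
apply: (@le_trans _ _ (m%:R * log2 m%:R)).
  by rewrite -log2X // ler_log2 // (lt_le_trans ltr01).
by rewrite ler_pM2l // le_max ler_log2 ?orbT // ltW.
Qed.

(** Since [n <= log2 D], one has [n * log2 n <= n * log2 (log2 D) <= log2 D]. *)
Lemma exp_self_le (R : realType) (n : nat) (D : R) :
  1 <= D -> (0 < n)%N -> n%:R <= log_over_loglog D -> n%:R ^+ n <= D.
Proof.
move=> D1 n0 nX; have nR : 0 < n%:R :> R by rewrite ltr0n.
have L1 : 1 <= Num.max 1 (log2 (log2 D)) by rewrite le_max lexx.
have D0 : 0 < D := lt_le_trans ltr01 D1.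
apply: le_of_log2 => //; first exact: exprn_gt0.
have nY : n%:R <= log2 D := le_trans nX (log_over_loglog_le D1).
rewrite log2X //; move: nX; rewrite /log_over_loglog ler_pdivlMr; last by lra.
apply: le_trans; rewrite ler_pM2l // le_max; apply/orP; right.
exact: ler_log2.
Qed.

(** * The lower bounds for the p-norm and the maximum norm *)

Lemma lpnorm_ratio (R : realType) (m : nat) (mu D p : R) (M : model)
    (A : online_algorithm R m) :
  1 <= mu -> mu <= m%:R -> 1 <= D -> D <= m%:R ^+ m ->
  inputs m GeneralLoads mu D !=set0 -> 1 <= p -> p <= log2 m%:R ->
  ((48^-1 * (mu `^ (p / (2 * p - 1) - 1 / p) + p
     + log_over_loglog D `^ (p / (2 * p - 1) - 1 / p)))%:E
   <= competitive_ratio (lpnorm p) A (inputs m M mu D))%E.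
Proof.
move=> mu1 mum D1 Dm inp p1 pm.
have m0 : (0 < m)%N by rewrite -(ltr_nat R); lra.
have X0 := log_over_loglog_ge0 D1.
have Xm := log_over_loglog_le_machines D1 Dm m0.
set X := log_over_loglog D in X0 Xm *.
have [/andP[ep0 ep1] _] := exponent_bounds p1.
set CR := competitive_ratio _ _ _; set ep := _ - _.
have CRp : ((p / 2)%:E <= CR)%E.
  (* The tournament gives [(k + 1) / 2^(k/p)], where [k + 1 > p] and [2^(k/p) <= 2]. *)
  pose k := Num.truncn p.
  have /andP[kp pk] : k%:R <= p < k.+1%:R by apply: truncn_itv; lra.
  have km : (2 ^ k <= m)%N.
    rewrite -(ler_nat R) natrX; apply: le_of_log2; rewrite ?exprn_gt0 ?ltr0n //.
    by rewrite log2X // log2_2 mulr1; lra.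
  apply: le_trans (tournament_ratio M A p1 D1 inp km); rewrite lee_fin.
  have k2 : (2 ^ k)%:R `^ p^-1 <= 2 :> R.
    rewrite natrX -powR_mulrn // -powRrM -[leRHS]powRr1 // ler_powR ?ler1n //.
    by rewrite ler_pdivrMr ?mul1r //; lra.
  rewrite ler_pdivlMr ?powR_gt0 ?ltr0n ?expn_gt0 //.
  apply: (@le_trans _ _ (p / 2 * 2)); last by lra.
  by rewrite ler_pM2l //; lra.
(* A power of a base below [2] is at most [2], so the bound [p / 2] already covers it. *)
have small Y : 0 <= Y -> Y < 2 -> ((Y `^ ep / 16)%:E <= CR)%E.
  move=> Y0 Y2; apply: le_trans CRp; rewrite lee_fin.
  have Y2' : Y `^ ep <= 2 `^ ep by apply: powR_lep => //; lra.
  have : 2 `^ ep <= 2 :> R by rewrite ler1_powR ?ler1n.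
  by lra.
have CRmu : ((mu `^ ep / 16)%:E <= CR)%E.
  have [mu2|mu2] := leP 2 mu; last by apply: small => //; lra.
  have [a [n [v [/andP[a0 an] nmu va vn le]]]] := window_parameters p1 mu2.
  apply: (@le_trans _ _ (v / (a + n)%:R `^ p^-1)%:E); first by rewrite lee_fin.
  apply: distortion_ratio => //.
    rewrite -(ler_nat R); apply: le_trans mum; apply: le_trans nmu.
    by rewrite ler_nat -addnn leq_add2r.
  by apply: le_trans nmu; rewrite ler_nat -addnn -addn1 leq_add2l (leq_trans a0).
have CRX : ((X `^ ep / 16)%:E <= CR)%E.
  have [X2|X2] := leP 2 X; last by apply: small.
  have [a [n [v [/andP[a0 an] nX va vn le]]]] := window_parameters p1 X2.
  apply: (@le_trans _ _ (v / (a + n)%:R `^ p^-1)%:E); first by rewrite lee_fin.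
  apply: duration_ratio => //.
    rewrite -(ler_nat R); apply: le_trans Xm; apply: le_trans nX.
    by rewrite ler_nat -addnn leq_add2r.
  apply: (@le_trans _ _ (n%:R ^+ n)).
    by rewrite lerXn2r ?nnegrE // ler_nat.
  apply: exp_self_le; rewrite ?(leq_trans a0) //.
  by apply: le_trans nX; rewrite ler_nat -addnn leq_addr.
(* Averaging the three bounds gives the constant [48 = 3 * 16]. *)
move: CRp CRmu CRX {small}; case: CR => [r| |]; rewrite ?leey // ?lee_fin ?leeNy_eq //.
lra.
Qed.

Lemma maxnorm_le_lpnorm (R : realType) (m : nat) (p : R) (v : 'I_m -> \bar R) :
  0 < p -> (maxnorm v <= lpnorm p v)%E.
Proof.
move=> p0; apply: bigmax_le => [|i _]; first exact: poweR_ge0.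
have -> : (`|v i| = (`|v i| `^ p) `^ p^-1)%E.
  by rewrite -poweRrM mulfV ?gt_eqF // poweRe1.
have s0 (P : pred 'I_m) : (0 <= \sum_(k | P k) `|v k| `^ p)%E.
  by rewrite sume_ge0 // => k _; exact: poweR_ge0.
apply: gt0_ler_poweR; rewrite ?invr_ge0 ?in_itv /= ?leey ?andbT ?poweR_ge0 ?(ltW p0) //.
by rewrite (bigD1 i) //= leeDl.
Qed.

Lemma lpnorm_le_maxnorm (R : realType) (m : nat) (p : R) (v : 'I_m -> \bar R) :
  0 < p -> (0 < m)%N -> (lpnorm p v <= (m%:R `^ p^-1)%:E * maxnorm v)%E.
Proof.
move=> p0 m0; have mR : 0 < m%:R :> R by rewrite ltr0n.
have vmax i : (`|v i| <= maxnorm v)%E by exact: le_bigmax.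
have max0 : (0 <= maxnorm v)%E by apply: le_trans (vmax (Ordinal m0)).
case E : (maxnorm v) max0 vmax => [r| |] // r0 vr; last first.
  by rewrite gt0_muley ?leey // lte_fin powR_gt0.
rewrite -EFinM; rewrite lee_fin in r0.
apply: (@le_trans _ _ (lpnorm p (fun _ : 'I_m => r%:E))); last first.
  rewrite /lpnorm abse_EFin ger0_norm // poweR_EFin sumEFin poweR_EFin lee_fin.
  rewrite sumr_const card_ord -[r `^ p *+ m]mulr_natl powRM ?powR_ge0 ?(ltW mR) //.
  by rewrite powRK ?gt_eqF.
have -> : lpnorm p v = lpnorm p (fun i => `|v i|)%E.
  by rewrite /lpnorm; under [in RHS]eq_bigr do rewrite abse_id.
by apply: ler_lpnorm => //; exact: ltW.
Qed.

(** The p-norm lies between the maximum norm and [m^(1/p)] times it, so passing to the maximum norm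
    does not raise the optimum and lowers the online objective by at most the factor [C]. *)
Lemma maxnorm_ratio (R : realType) (m : nat) (p C : R) (A : online_algorithm R m)
    (I : set (instance R m)) :
  0 < p -> (0 < m)%N -> m%:R `^ p^-1 <= C ->
  (competitive_ratio (lpnorm p) A I <= C%:E * competitive_ratio (@maxnorm R m) A I)%E.
Proof.
move=> p0 m0 mC; have C0 : 0 < C by apply: lt_le_trans mC; rewrite powR_gt0 ?ltr0n.
have lp0 (w : 'I_m -> \bar R) : (0 <= lpnorm p w)%E by exact: poweR_ge0.
have mx0 (w : 'I_m -> \bar R) : (0 <= maxnorm w)%E.
  by apply: le_trans (le_bigmax _ _ (Ordinal m0)).
apply: ge_ereal_sup => _ [s Is <-].
apply: (@le_trans _ _ (C%:E *
    (objective (@maxnorm R m) (run A s) / opt (@maxnorm R m) s))%E); last first.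
  by rewrite lee_pmul2l // ?lte_fin //; apply: ereal_sup_ubound; exists s.
rewrite muleA; apply: lee_pmul; rewrite ?inve_ge0 ?objective_ge0 ?opt_ge0 //.
  apply: ge_ereal_sup => _ [t _ <-].
  apply: le_trans (lpnorm_le_maxnorm _ p0 m0) _.
  apply: lee_pmul; rewrite ?lee_fin ?powR_ge0 ?mx0 //.
  by apply: ereal_sup_ubound; exists t.
rewrite lee_pV2 ?inE ?opt_ge0 //.
apply: le_ereal_inf_tmp => _ [b _ <-].
apply: (@le_trans _ _ (objective (@maxnorm R m) b)).
  by apply: ereal_inf_lbound; exists b.
apply: ge_ereal_sup => _ [t _ <-]; apply: le_trans (maxnorm_le_lpnorm _ p0) _.
by apply: ereal_sup_ubound; exists t.
Qed.

Theorem theorem2 (R : realType) :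
  exists2 c : R, 0 < c &
  forall (m : nat) (mu D : R),
    1 <= mu -> mu <= m%:R ->
    1 <= D -> D <= m%:R ^+ m ->
    inputs m GeneralLoads mu D !=set0 ->
    (forall (p : R), 1 <= p -> p <= log2 m%:R ->
      forall (M : model) (A : online_algorithm R m),
        ((c * (mu `^ (p / (2 * p - 1) - 1 / p) + p
               + log_over_loglog D `^ (p / (2 * p - 1) - 1 / p)))%:E
         <= competitive_ratio (lpnorm p) A (inputs m M mu D))%E)
    /\
    (forall (M : model) (A : online_algorithm R m),
        ((c * (Num.sqrt mu + log2 m%:R + Num.sqrt (log_over_loglog D)))%:E
         <= competitive_ratio (@maxnorm R m) A (inputs m M mu D))%E).
Proof.
(* [192 = 48 * 2 * 2]: one factor [2] compares the norms, the other compares [sqrt Y] with the power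
   of [Y]. *)
exists (192^-1) => [|m mu D mu1 mum D1 Dm inp]; first by rewrite invr_gt0.
have m0 : (0 < m)%N by rewrite -(ltr_nat R); lra.
have X0 := log_over_loglog_ge0 D1.
have Xm := log_over_loglog_le_machines D1 Dm m0.
split=> [p p1 pm M A|M A].
  apply: le_trans (lpnorm_ratio M A mu1 mum D1 Dm inp p1 pm); rewrite lee_fin.
  apply: ler_wpM2r; last by lra.
  by rewrite !addr_ge0 ?powR_ge0 //; lra.
(* For [m = 1] no [p] lies between [1] and [log2 m]; then [mu = D = 1], and the tournament with
   [k = 0] gives the ratio [1]. *)
have [m1|m1] := leqP m 1.
  have {m0} {}m1 : m = 1%N by lia.
  subst m; rewrite expr1 in Dm.
  have muE : mu = 1 by apply/eqP; rewrite eq_le mu1 mum.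
  have DE : D = 1 by apply/eqP; rewrite eq_le D1 Dm.
  subst mu D.
  have := maxnorm_ratio A (inputs 1 M 1 1) (ltr01 : 0 < 1 :> R) isT (_ : _ <= 1).
  rewrite powR1 => /(_ (lexx _)); rewrite mul1e; apply: le_trans.
  have := tournament_ratio (k := 0) M A (lexx (1 : R)) D1 inp isT.
  apply: le_trans; rewrite lee_fin /log_over_loglog log2_1 mul0r sqrtr0 sqrtr1.
  by rewrite powR1; lra.
pose p := log2 m%:R : R.
have p1 : 1 <= p by rewrite -(log2_2 R) ler_log2 // ler_nat.
have p0 : 0 < p by lra.
have mp : m%:R `^ p^-1 = 2 :> R.
  have mR : 0 < m%:R :> R by rewrite ltr0n.
  have lnm : ln m%:R != 0 :> R by rewrite gt_eqF // ln_gt0 // ltr1n.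
  rewrite /powR gt_eqF // /p /log2 invf_div divfK //.
  by rewrite lnK // posrE.
(* The exponent plus [1/p] is at least [1/2], and [Y^(1/p) <= m^(1/p) = 2]. *)
have half Y : 1 <= Y -> Y <= m%:R ->
    Num.sqrt Y <= 2 * Y `^ (p / (2 * p - 1) - 1 / p).
  move=> Y1 Ym; have [_ /andP[e2 _]] := exponent_bounds p1.
  rewrite -powR12_sqrt; last by lra.
  apply: (@le_trans _ _ (Y `^ p^-1 * Y `^ (p / (2 * p - 1) - 1 / p))).
    rewrite -powRD; last by rewrite (gt_eqF (lt_le_trans ltr01 Y1)) implybT.
    by rewrite ler_powR //; lra.
  rewrite ler_wpM2r ?powR_ge0 // -[leRHS]mp powR_lep //; last by lra.
  by rewrite invr_ge0 ltW.
have mpl : m%:R `^ p^-1 <= 2 :> R by rewrite mp.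
have := maxnorm_ratio A (inputs m M mu D) p0 m0 mpl.
move=> /(le_trans (lpnorm_ratio M A mu1 mum D1 Dm inp p1 (lexx _))).
rewrite -lee_pdivrMl //; apply: le_trans; rewrite -EFinM lee_fin.
have hmu := half _ mu1 mum.
(* [half] needs a base at least [1]; below that the square root is at most [1 <= p]. *)
have hX : Num.sqrt (log_over_loglog D) <=
    p + 2 * log_over_loglog D `^ (p / (2 * p - 1) - 1 / p).
  have [X1|X1] := leP 1 (log_over_loglog D).
    by have := half _ X1 Xm; lra.
  have sX : Num.sqrt (log_over_loglog D) <= 1.
    by rewrite -sqrtr1 ler_wsqrtr // ltW.
  by have := powR_ge0 (log_over_loglog D) (p / (2 * p - 1) - 1 / p); lra.
rewrite -/p; set x := _ `^ _ in hmu *; set y := _ `^ _ in hX *.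
by lra.
Qed.
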